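(* Let $n\ge2$, $\lambda\in\mathbb{R}$, and let $g=dx^2+\psi^2(x)g_{\mathbb{S}^n}$ with potential $\phi=\phi(x)$, $\omega=\dot\phi$, be a singular gradient Ricci soliton of the kind described in the context. Let $\rho_t$ be the flow given by $\partial_t\rho_t(x)=\frac{1}{1+2\lambda t}\,\omega(\rho_t(x))$, $\rho_0(x)=x$, for $x\in(0,\delta)$ and $t\in[0,T]$, with $\delta,T>0$ small and $1+2\lambda t>0$ on $[0,T]$. Then for each $t\in(0,T]$ $$\rho_t\big((0,\delta)\big)\subseteq(m(t),+\infty)\quad\text{with } m(t)>0 ,$$ and in particular $\rho_t$ is not surjective. Moreover $m(t)$ is non-decreasing.
   Context: $g_{\mathbb{S}^n}$ is the canonical metric of the unit $n$-sphere. The solitons: $(W,X,Y)(y)$, $y\le0$, solves $W'=W(X^2-\lambda W^2)$, $X'=X^3-X+\frac{Y^2}{\sqrt n}+\lambda(\sqrt n-X)W^2$, $Y'=Y(X^2-\frac X{\sqrt n}-\lambda W^2)$ with $W(0)>0$, $Y(0)>0$ and $(W,X,Y)(0)$ sufficiently close to $(0,1,0)$; and $x=\int_{-\infty}^yW\,dy$, $\psi=\sqrt{n(n-1)}\,W/Y$, $\omega=(\sqrt nX-1)/W$. Then $\mathrm{Ric}(g)+\nabla\nabla\phi+\lambda g=0$, and $\psi\sim ax^{1/\sqrt n}$ ($a>0$), $\omega\sim\frac{\sqrt n-1}{x}$ as $x\to0^+$. The metric $g(t)=(1+2\lambda t)\rho_t^*g$ is the evolution of $g$ under the Ricci flow.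 Here $\delta$ and $T$ are small enough that $\rho_t(x)$ remains in the domain of the soliton near $x=0$ for $x\in(0,\delta)$, $t\in[0,T]$; $m(t)$ denotes $\inf_{x\in(0,\delta)}\rho_t(x)=\lim_{x\to0^+}\rho_t(x)$; non-surjectivity is as a map into $(0,+\infty)$. *)

(* Defs.v *)
From Stdlib Require Import Reals.
From Coquelicot Require Import Coquelicot.
Open Scope R_scope.

(* [D_in f d D y] says that the difference quotients of [f] at [y], taken inside
   the set [D], tend to [d y]: the ordinary derivative at interior points of
   [D], the one-sided derivative at its endpoints. *)
Record solves_soliton_ode (n : nat) (lambda : R) (W X Y : R -> R) : Prop := {
  ode_W : forall y, y <= 0 ->
    D_in W (fun s => W s * (X s ^ 2 - lambda * W s ^ 2)) (fun s => s <= 0) y;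
  ode_X : forall y, y <= 0 ->
    D_in X (fun s => X s ^ 3 - X s + Y s ^ 2 / sqrt (INR n)
                     + lambda * (sqrt (INR n) - X s) * W s ^ 2)
      (fun s => s <= 0) y;
  ode_Y : forall y, y <= 0 ->
    D_in Y (fun s => Y s * (X s ^ 2 - X s / sqrt (INR n) - lambda * W s ^ 2))
      (fun s => s <= 0) y
}.

(* x(y) = int_{-oo}^y W, an improper Riemann integral. *)
Definition x_coord (W : R -> R) (y : R) : R :=
  RInt_gen W (Rbar_locally m_infty) (at_point y).

(* The image of y <= 0 under x, on which psi, phi and omega live. *)
Definition soliton_domain (W : R -> R) (x : R) : Prop := 0 < x <= x_coord W 0.

(* The data of the metric dx^2 + psi(x)^2 g_{S^n} and of the potential phi,
   with omega the derivative of phi, for a trajectory issuing from a point at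
   distance less than [eps] from (0,1,0). The profiles are constrained only on
   [soliton_domain W]. The convergence of the integral defining x, the soliton
   equation and the asymptotics of psi and omega at x = 0 are consequences for
   small [eps] and are not part of the definition. *)
Record singular_soliton (n : nat) (lambda eps : R)
    (W X Y psi phi omega : R -> R) : Prop := {
  sol_ode : solves_soliton_ode n lambda W X Y;
  sol_W0 : 0 < W 0;
  sol_Y0 : 0 < Y 0;
  sol_close : Rabs (W 0) < eps /\ Rabs (X 0 - 1) < eps /\ Rabs (Y 0) < eps;
  sol_psi : forall y, y <= 0 ->
    psi (x_coord W y) = sqrt (INR n * (INR n - 1)) * W y / Y y;
  sol_omega : forall y, y <= 0 ->
    omega (x_coord W y) = (sqrt (INR n) * X y - 1) / W y;
  sol_phi : forall x, soliton_domain W x ->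
    D_in phi omega (soliton_domain W) x
}.

(* [rho t x] is rho_t(x). *)
Record soliton_flow (lambda : R) (W omega : R -> R) (delta T : R)
    (rho : R -> R -> R) : Prop := {
  flow_init : forall x, 0 < x < delta -> rho 0 x = x;
  flow_dom : forall t x, 0 <= t <= T -> 0 < x < delta ->
    soliton_domain W (rho t x);
  flow_ode : forall t x, 0 <= t <= T -> 0 < x < delta ->
    D_in (fun s => rho s x)
      (fun s => / (1 + 2 * lambda * s) * omega (rho s x))
      (fun s => 0 <= s <= T) t
}.

(* m(t), the infimum of rho_t over (0,delta). For a flow as above with
   delta > 0 and 0 <= t <= T the set is nonempty and bounded below by 0, so that
   [real] is applied to a finite value. *)
Definition flow_inf (rho : R -> R -> R) (delta t : R) : R :=
  real (Glb_Rbar (fun z => exists x, 0 < x < delta /\ z = rho t x)).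

(* Main.v *)
Require Import Defs.
From Stdlib Require Import Reals Lra Classical.
From Coquelicot Require Import Coquelicot.
Open Scope R_scope.

(** The point (W,X,Y) = (0,1,0) is a source of the soliton system: the
    linearization there has the positive eigenvalues 1, 2 and 1 - 1/sqrt n.
    Accordingly W^2 + (X-1)^2 + Y^2 is nondecreasing along solutions near that
    point, so a trajectory that ends close to it was close to it for all y <= 0
    ([backward_trapping], [soliton_source_trajectory]). There W' lies between
    W/2 and 3W/2, which has three consequences: W stays positive, W decays
    exponentially as y -> -oo, and the arclength x = int W is finite and
    comparable to W, namely 2W/3 <= x <= 2W ([source_arclength]). As
    omega = (sqrt n X - 1)/W with sqrt n X - 1 >= 1/5, this gives
    x omega(x) >= 2/15, a weak form of omega ~ (sqrt n - 1)/x; moreover omega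
    is Lipschitz away from x = 0 ([soliton_singular_field]).

    Only these two properties of omega matter for the flow. Since omega > 0,
    rho_t(x) increases in t, and so does m(t). Since
    d/dt rho^2 = 2 rho omega(rho)/(1+2 lambda t) is bounded below by a positive
    constant c, rho_t(x)^2 >= c t uniformly in x ([flow_sq_lower]): this is why
    m(t) > 0 as soon as t > 0. Uniqueness for a Lipschitz field keeps distinct
    trajectories apart, so rho_t is strictly increasing in x
    ([flow_incr_space]). Its infimum is then its limit at 0+ and is not
    attained, and no value in (0, m(t)) is attained either. *)

(** * One-sided derivatives and differential inequalities *)

(** Derivatives relative to a closed set D are turned into ordinary ones by
    prolonging [f] linearly outside D, with the slope found at the nearest
    point [p x] of D. This lets the calculus of [is_derive] apply up to the
    endpoints. The second hypothesis holds for nearest-point projections onto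
    intervals: points outside D close to x are sent where x is sent. *)
Lemma closed_extension (D : R -> Prop) (p f d : R -> R) :
  (forall x, D x -> p x = x) ->
  (forall x, locally x (fun z => ~ D z -> p z = p x)) ->
  (forall x, ~ D x -> locally x (fun z => ~ D z)) ->
  (forall x, D x -> D_in f d D x) ->
  exists g, (forall x, D x -> g x = f x) /\
            (forall x, is_derive g x (d (p x))).
Proof.
  intros pD ploc Dcl Hf.
  exists (fun x => f (p x) + d (p x) * (x - p x)).
  split.
  { intros x Hx. rewrite (pD x Hx). ring. }
  intros x. destruct (classic (D x)) as [Hx|Hx].
  - apply is_derive_Reals. intros e He.
    destruct (Hf x Hx e He) as [al [Hal H]].
    destruct (ploc x) as [be Hbe].
    assert (Hm : 0 < Rmin al be) by (apply Rmin_pos; [exact Hal | apply cond_pos]).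
    exists (mkposreal _ Hm). intros h Hh0 Hh. simpl in Hh.
    pose proof (Rmin_l al be). pose proof (Rmin_r al be).
    rewrite (pD x Hx).
    destruct (classic (D (x + h))) as [Hxh|Hxh].
    + rewrite (pD _ Hxh).
      specialize (H (x + h)).
      unfold Rdist in H. simpl in H. unfold Rdist in H.
      replace ((f (x + h) + d (x + h) * (x + h - (x + h))
                - (f x + d x * (x - x))) / h - d x)
        with ((f (x + h) - f x) / (x + h - x) - d x)
        by (field; repeat split; lra).
      apply H. split.
      * split; [exact Hxh | lra].
      * replace (x + h - x) with h by ring. lra.
    + rewrite (Hbe (x + h)), (pD x Hx).
      * replace ((f x + d x * (x + h - x) - (f x + d x * (x - x))) / h - d x)
          with 0 by (field; exact Hh0).
        rewrite Rabs_R0. exact He.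
      * change (Rabs (x + h - x) < be). replace (x + h - x) with h by ring. lra.
      * exact Hxh.
  - apply is_derive_ext_loc with (fun z => f (p x) + d (p x) * (z - p x)).
    + generalize (filter_and _ _ (ploc x) (Dcl x Hx)).
      apply filter_imp. intros z [H1 H2]. rewrite (H1 H2). reflexivity.
    + auto_derive; [exact I | ring].
Qed.

Lemma halfline_extension (f d : R -> R) (b : R) :
  (forall x, x <= b -> D_in f d (fun s => s <= b) x) ->
  exists g g', (forall x, x <= b -> g x = f x) /\
    (forall x, is_derive g x (g' x)) /\ (forall x, x <= b -> g' x = d x).
Proof.
  intros H.
  destruct (closed_extension (fun s => s <= b) (fun x => Rmin x b) f d)
    as [g [Hg Hg']].
  - intros x Hx. apply Rmin_left. exact Hx.
  - intros x. destruct (Rlt_le_dec x b) as [Hx|Hx].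
    + apply filter_imp with (2 := open_lt b x Hx). intros z Hz Hn. lra.
    + apply filter_forall. intros z Hz. rewrite !Rmin_right; lra.
  - intros x Hx. assert (Hx' : b < x) by lra.
    apply filter_imp with (2 := open_gt b x Hx'). intros z Hz. lra.
  - exact H.
  - exists g, (fun x => d (Rmin x b)). split; [exact Hg | split; [exact Hg' |]].
    intros x Hx. rewrite Rmin_left; [reflexivity | exact Hx].
Qed.

Lemma segment_extension (f d : R -> R) (a b : R) : a < b ->
  (forall x, a <= x <= b -> D_in f d (fun s => a <= s <= b) x) ->
  exists g g', (forall x, a <= x <= b -> g x = f x) /\
    (forall x, is_derive g x (g' x)) /\ (forall x, a <= x <= b -> g' x = d x).
Proof.
  intros ab H.
  assert (pin : forall x, a <= x <= b -> Rmax a (Rmin x b) = x).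
  { intros x Hx. rewrite Rmin_left, Rmax_right; lra. }
  assert (pl : forall x, x <= a -> Rmax a (Rmin x b) = a).
  { intros x Hx. rewrite Rmin_left, Rmax_left; lra. }
  assert (pr : forall x, b <= x -> Rmax a (Rmin x b) = b).
  { intros x Hx. rewrite Rmin_right, Rmax_right; lra. }
  destruct (closed_extension (fun s => a <= s <= b)
              (fun x => Rmax a (Rmin x b)) f d) as [g [Hg Hg']].
  - exact pin.
  - intros x. destruct (Rle_lt_dec x a) as [Hx|Hx].
    + assert (Hb : x < b) by lra.
      apply filter_imp with (2 := open_lt b x Hb). intros z Hz Hn.
      rewrite !pl; lra.
    + destruct (Rle_lt_dec b x) as [Hx'|Hx'].
      * apply filter_imp with (2 := open_gt a x Hx). intros z Hz Hn.
        rewrite !pr; lra.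
      * generalize (filter_and _ _ (open_gt a x Hx) (open_lt b x Hx')).
        apply filter_imp. intros z Hz Hn. lra.
  - intros x Hx. destruct (Rlt_le_dec x a) as [Hx'|Hx'].
    + apply filter_imp with (2 := open_lt a x Hx'). intros z Hz. lra.
    + assert (Hb : b < x) by lra.
      apply filter_imp with (2 := open_gt b x Hb). intros z Hz. lra.
  - exact H.
  - exists g, (fun x => d (Rmax a (Rmin x b))).
    split; [exact Hg | split; [exact Hg' |]].
    intros x Hx. rewrite pin; [reflexivity | exact Hx].
Qed.

Lemma derive_continuity (f f' : R -> R) :
  (forall x, is_derive f x (f' x)) -> continuity f.
Proof.
  intros H x. apply derivable_continuous_pt. exists (f' x).
  apply is_derive_Reals. apply H.
Qed.

Lemma mean_value (f f' : R -> R) (a b : R) : a < b ->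
  (forall x, a <= x <= b -> is_derive f x (f' x)) ->
  exists c, a < c < b /\ f b - f a = f' c * (b - a).
Proof.
  intros ab H.
  destruct (MVT_cor2 f f' a b ab) as [c [H1 H2]].
  - intros c Hc. apply is_derive_Reals. apply H. exact Hc.
  - exists c. split; assumption.
Qed.

Lemma derive_nonneg_incr (f f' : R -> R) (a b : R) : a <= b ->
  (forall x, a <= x <= b -> is_derive f x (f' x)) ->
  (forall x, a <= x <= b -> 0 <= f' x) -> f a <= f b.
Proof.
  intros ab H H0. destruct (Req_dec a b) as [->|ne]; [lra|].
  destruct (mean_value f f' a b) as [c [Hc E]]; [lra | exact H |].
  specialize (H0 c). nra.
Qed.

(** If |u'| <= K |u|, then u^2 exp(2Kt) is nondecreasing and u^2 exp(-2Kt) is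
    nonincreasing, so a zero of u at one time propagates to all times. *)
Lemma linear_growth_nonzero (u u' : R -> R) (K a b : R) :
  (forall t, is_derive u t (u' t)) ->
  (forall t, a <= t <= b -> Rabs (u' t) <= K * Rabs (u t)) ->
  forall c t, a <= c <= b -> a <= t <= b -> u c <> 0 -> u t <> 0.
Proof.
  intros Hu HK c t Hc Ht Hne H0.
  assert (Hprod : forall x, a <= x <= b -> Rabs (u x * u' x) <= K * (u x) ^ 2).
  { intros x Hx. rewrite Rabs_mult, <- pow2_abs.
    pose proof (HK x Hx). pose proof (Rabs_pos (u x)). nra. }
  assert (Hder : forall s x, is_derive (fun t => u t ^ 2 * exp (s * t)) x
            ((2 * (u x * u' x) + s * u x ^ 2) * exp (s * x))).
  { intros s x. auto_derive; [exists (u' x); apply Hu |].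
    rewrite (is_derive_unique (fun z : R => u z) _ _ (Hu x)). ring. }
  assert (Hc2 : 0 < u c ^ 2) by nra.
  destruct (Rle_lt_dec c t) as [ct|tc].
  - assert (H := derive_nonneg_incr _ _ c t ct (fun x _ => Hder (2 * K) x)).
    simpl in H. rewrite H0 in H.
    assert (Hin : u c * (u c * 1) * exp (2 * K * c)
                    <= 0 * (0 * 1) * exp (2 * K * t)).
    { apply H. intros x Hx. apply Rmult_le_pos; [|left; apply exp_pos].
      assert (Hx' : a <= x <= b) by lra.
      pose proof (Hprod x Hx') as Hp. apply Rabs_le_between in Hp. simpl in Hp. lra. }
    pose proof (exp_pos (2 * K * c)). nra.
  - assert (tc' : t <= c) by lra.
    assert (Hd : forall x, is_derive (fun t => - (u t ^ 2 * exp (- (2 * K) * t))) x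
       (- ((2 * (u x * u' x) + - (2 * K) * u x ^ 2) * exp (- (2 * K) * x)))).
    { intros x. apply @is_derive_opp. apply Hder. }
    assert (H := derive_nonneg_incr _ _ t c tc' (fun x _ => Hd x)).
    simpl in H. rewrite H0 in H.
    assert (Hin : - (0 * (0 * 1) * exp (- (2 * K) * t))
                   <= - (u c * (u c * 1) * exp (- (2 * K) * c))).
    { apply H. intros x Hx. assert (Hx' : a <= x <= b) by lra.
      pose proof (Hprod x Hx') as Hp. apply Rabs_le_between in Hp. simpl in Hp.
      pose proof (exp_pos (- (2 * K) * x)). nra. }
    pose proof (exp_pos (- (2 * K) * c)). nra.
Qed.

Lemma linear_growth_pos (u u' : R -> R) (K a b : R) :
  (forall t, is_derive u t (u' t)) ->
  (forall t, a <= t <= b -> Rabs (u' t) <= K * Rabs (u t)) ->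
  forall c t, a <= c <= b -> a <= t <= b -> 0 < u c -> 0 < u t.
Proof.
  intros Hu HK c t Hc Ht Hpos.
  destruct (Rlt_le_dec 0 (u t)) as [H|H]; [exact H | exfalso].
  destruct (IVT_gen u c t 0 (derive_continuity u u' Hu)) as [z [Hz Hz0]].
  - split; [rewrite Rmin_right | rewrite Rmax_left]; lra.
  - revert Hz0. apply (linear_growth_nonzero u u' K a b Hu HK c z Hc).
    + revert Hz. unfold Rmin, Rmax. destruct (Rle_dec c t); lra.
    + lra.
Qed.

(** Were the sublevel set left, let s be the last time at which V >= e. On
    (s,0] one has V < e, hence V is nondecreasing there and V(0) >= V(s) >= e. *)
Lemma backward_trapping (V V' : R -> R) (e : R) :
  (forall y, is_derive V y (V' y)) -> V 0 < e ->
  (forall y, y <= 0 -> V y < e -> 0 <= V' y) ->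
  forall y, y <= 0 -> V y < e.
Proof.
  intros HV H0 Hinc y Hy.
  destruct (Rlt_le_dec (V y) e) as [H|H]; [exact H | exfalso].
  set (E := fun s => s <= 0 /\ e <= V s).
  destruct (completeness E) as [s [Hub Hlub]].
  - exists 0. intros s [Hs _]. exact Hs.
  - exists y. split; assumption.
  - assert (Hs0 : s <= 0) by (apply Hlub; intros z [Hz _]; exact Hz).
    assert (Hafter : forall z, s < z -> z <= 0 -> V z < e).
    { intros z Hz Hz0. destruct (Rlt_le_dec (V z) e) as [L|L]; [exact L|].
      assert (z <= s) by (apply Hub; split; assumption). lra. }
    assert (HVs : e <= V s).
    { destruct (Rlt_le_dec (V s) e) as [L|L]; [exfalso | exact L].
      assert (C : continuous V s).
      { apply (ex_derive_continuous V). exists (V' s). apply HV. }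
      destruct (C (fun r => r < e) (open_lt e (V s) L)) as [d Hd].
      assert (Hb : is_upper_bound E (s - d)).
      { intros z Hz. destruct (Rle_lt_dec z (s - d)) as [l|l]; [exact l|].
        assert (z <= s) by (apply Hub; exact Hz).
        assert (V z < e).
        { apply Hd. change (Rabs (z - s) < d). apply Rabs_def1; lra. }
        destruct Hz. lra. }
      apply Hlub in Hb. pose proof (cond_pos d). lra. }
    assert (Hlt : s < 0).
    { destruct (Req_dec s 0) as [E0|]; [rewrite E0 in HVs; lra | lra]. }
    destruct (mean_value V V' s 0 Hlt) as [c [Hc Ec]].
    { intros x _. apply HV. }
    assert (0 <= V' c) by (apply Hinc; [lra | apply Hafter; lra]).
    nra.
Qed.

(** * The source at (0,1,0) *)

(** Chosen so that e, |lambda| e, sqrt n e and |lambda| sqrt n e are all at most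
    1/40: these four quantities control every perturbation term of the system. *)
Definition nbhd_radius (n : nat) (lambda : R) : R :=
  / (40 * (1 + Rabs lambda) * (1 + sqrt (INR n))).

(** The hypothesis n >= 2 acts through this bound: it keeps 1 - 1/sqrt n, the
    eigenvalue of the linearization in the direction of Y, and sqrt n - 1, the
    value of sqrt n X - 1 at the source, away from 0. *)
Lemma sqrt_INR_bound (n : nat) : (2 <= n)%nat -> 7 / 5 <= sqrt (INR n).
Proof.
  intros hn. apply le_INR in hn. simpl in hn.
  rewrite <- (sqrt_square (7 / 5)) by lra. apply sqrt_le_1_alt. lra.
Qed.

Lemma nbhd_radius_bounds (n : nat) (lambda : R) :
  let e := nbhd_radius n lambda in
  0 < e <= / 40 /\ Rabs lambda * e <= / 40 /\ sqrt (INR n) * e <= / 40 /\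
  Rabs lambda * e * sqrt (INR n) <= / 40.
Proof.
  intros e. unfold e, nbhd_radius.
  pose proof (Rabs_pos lambda) as HL. pose proof (sqrt_pos (INR n)) as HS.
  set (L := Rabs lambda) in *. set (s := sqrt (INR n)) in *.
  set (D := (1 + L) * (1 + s)).
  assert (HD : 1 <= D) by (unfold D; nra).
  replace (/ (40 * (1 + L) * (1 + s))) with (/ 40 * / D)
    by (unfold D; field; split; lra).
  assert (HI : 0 < / D) by (apply Rinv_0_lt_compat; lra).
  assert (HDI : D * / D = 1) by (apply Rinv_r; lra).
  assert (L <= D) by (unfold D; nra). assert (s <= D) by (unfold D; nra).
  assert (L * s <= D) by (unfold D; nra).
  repeat split; nra.
Qed.

(** With (w,x,v) the values of (W,X,Y), the four conclusions bound W'/W,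
    the numerator of omega, X', and half the derivative of
    W^2 + (X-1)^2 + Y^2. The last one is nonnegative because, after the mixed
    terms containing x - 1 are shared out, it is a combination of w^2, (x-1)^2
    and v^2 whose coefficients are close to 1, 2 and 1 - 1/sqrt n. *)
Lemma nbhd_estimates (n : nat) (lambda w x v : R) : (2 <= n)%nat ->
  let s := sqrt (INR n) in
  w ^ 2 + (x - 1) ^ 2 + v ^ 2 < nbhd_radius n lambda ^ 2 ->
  1 / 2 <= x ^ 2 - lambda * w ^ 2 <= 3 / 2 /\
  1 / 5 <= s * x - 1 <= 2 * s /\
  Rabs (x ^ 3 - x + v ^ 2 / s + lambda * (s - x) * w ^ 2) <= 1 /\
  0 <= w * (w * (x ^ 2 - lambda * w ^ 2)) +
       (x - 1) * (x ^ 3 - x + v ^ 2 / s + lambda * (s - x) * w ^ 2) +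
       v * (v * (x ^ 2 - x / s - lambda * w ^ 2)).
Proof.
  intros hn s HV.
  pose proof (sqrt_INR_bound n hn) as Hs. fold s in Hs.
  destruct (nbhd_radius_bounds n lambda) as [[He0 He] [HL [HS HLS]]].
  fold s in HS, HLS.
  set (e := nbhd_radius n lambda) in *.
  pose proof (Rabs_pos lambda) as HL0.
  pose proof (pow2_ge_0 w). pose proof (pow2_ge_0 v).
  pose proof (pow2_ge_0 (x - 1)).
  assert (Hw : w ^ 2 <= e ^ 2) by lra.
  assert (Hx : Rabs (x - 1) <= e).
  { rewrite <- (Rabs_pos_eq e) by lra. apply Rsqr_le_abs_0. unfold Rsqr. lra. }
  apply Rabs_le_between in Hx.
  assert (Hv : v ^ 2 <= e ^ 2) by lra.
  assert (Hlw : Rabs (lambda * w ^ 2) <= / 1600).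
  { rewrite Rabs_mult, (Rabs_pos_eq (w ^ 2)) by nra. nra. }
  (* The factor e here is later supplied by |x - 1| <= e or by w^2 <= e^2. *)
  assert (Hls : Rabs (lambda * (s - x)) * e <= / 10).
  { rewrite Rabs_mult.
    assert (Rabs (s - x) <= s + 2) by (apply Rabs_le; lra).
    pose proof (Rabs_pos (s - x)). nra. }
  assert (Hi : 0 < / s <= 5 / 7).
  { split; [apply Rinv_0_lt_compat; lra|].
    replace (5 / 7) with (/ (7 / 5)) by field. apply Rinv_le_contravar; lra. }
  apply Rabs_le_between in Hlw.
  unfold Rdiv. set (i := / s) in *. set (m := lambda * (s - x)) in *.
  set (q := lambda * w ^ 2) in *.
  assert (Hm : Rabs m * w ^ 2 <= / 400).
  { pose proof (Rabs_pos m). assert (Rabs m * w ^ 2 <= Rabs m * e ^ 2) by nra. nra. }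
  assert (Hx2 : 9 / 10 <= x ^ 2 <= 11 / 10) by nra.
  assert (Hmx : Rabs (m * (x - 1)) <= / 10).
  { rewrite Rabs_mult. pose proof (Rabs_pos m).
    assert (Rabs (x - 1) <= e) by (apply Rabs_le; lra). nra. }
  apply Rabs_le_between in Hmx.
  repeat split.
  - lra.
  - lra.
  - nra.
  - nra.
  - assert (Hmw : Rabs (m * w ^ 2) <= / 400).
    { rewrite Rabs_mult, (Rabs_pos_eq (w ^ 2)) by nra. exact Hm. }
    apply Rabs_le_between in Hmw. apply Rabs_le.
    assert (- / 4 <= x ^ 3 - x <= / 4) by (simpl in *; split; nra).
    assert (0 <= v ^ 2 * i <= / 4) by (split; nra).
    lra.
  - replace (_ + _) with (w ^ 2 * (x ^ 2 - q + m * (x - 1))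
      + (x - 1) ^ 2 * (x * (x + 1)) + v ^ 2 * (x ^ 2 - i - q))
      by (ring).
    assert (0 <= x ^ 2 - q + m * (x - 1)) by lra.
    assert (0 <= x * (x + 1)) by nra.
    assert (0 <= x ^ 2 - i - q) by lra.
    repeat apply Rplus_le_le_0_compat; apply Rmult_le_pos; assumption.
Qed.

(** What the ODE is needed for, freed from n, lambda and Y. The functions are
    differentiable on the whole line, whereas the estimates hold only on the
    half-line where the trajectory lives. *)
Record source_trajectory (s : R) (W W' X X' : R -> R) : Prop := {
  st_dW : forall y, is_derive W y (W' y);
  st_dX : forall y, is_derive X y (X' y);
  st_pos : forall y, y <= 0 -> 0 < W y;
  st_W' : forall y, y <= 0 -> W y / 2 <= W' y <= 3 / 2 * W y;
  st_X : forall y, y <= 0 -> 1 / 5 <= s * X y - 1 <= 2 * s;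
  st_X' : forall y, y <= 0 -> Rabs (X' y) <= 1
}.

(** Trapping by V = W^2 + (X-1)^2 + Y^2 makes the estimates near the source hold
    for all y <= 0; positivity of W follows from W(0) > 0 and |W'| <= 3/2 |W|. *)
Lemma soliton_source_trajectory (n : nat) (lambda : R) (W X Y : R -> R) :
  (2 <= n)%nat -> solves_soliton_ode n lambda W X Y -> 0 < W 0 ->
  W 0 ^ 2 + (X 0 - 1) ^ 2 + Y 0 ^ 2 < nbhd_radius n lambda ^ 2 ->
  exists W1 W1' X1 X1',
    (forall y, y <= 0 -> W1 y = W y) /\ (forall y, y <= 0 -> X1 y = X y) /\
    source_trajectory (sqrt (INR n)) W1 W1' X1 X1'.
Proof.
  intros hn [HW HX HY] HW0 HV0.
  apply halfline_extension in HW. destruct HW as [w [w' [Ew [Hw Ew']]]].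
  apply halfline_extension in HX. destruct HX as [x [x' [Ex [Hx Ex']]]].
  apply halfline_extension in HY. destruct HY as [v [v' [Ev [Hv Ev']]]].
  exists w, w', x, x'. split; [exact Ew|]. split; [exact Ex|].
  assert (HV : forall y, is_derive (fun y => w y ^ 2 + (x y - 1) ^ 2 + v y ^ 2) y
     (2 * (w y * w' y + (x y - 1) * x' y + v y * v' y))).
  { intros y. auto_derive.
    - repeat split; eexists; [apply Hw | apply Hx | apply Hv].
    - rewrite (is_derive_unique (fun z : R => w z) _ _ (Hw y)), (is_derive_unique (fun z : R => x z) _ _ (Hx y)),
        (is_derive_unique (fun z : R => v z) _ _ (Hv y)). ring. }
  assert (Htrap : forall y, y <= 0 ->
            w y ^ 2 + (x y - 1) ^ 2 + v y ^ 2 < nbhd_radius n lambda ^ 2).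
  { apply (backward_trapping _ _ _ HV).
    - rewrite Ew, Ex, Ev by lra. exact HV0.
    - intros y Hy Hlt.
      destruct (nbhd_estimates n lambda _ _ _ hn Hlt) as [_ [_ [_ H]]].
      rewrite Ew', Ex', Ev' by exact Hy.
      rewrite <- Ew, <- Ex, <- Ev by exact Hy. lra. }
  assert (Hwk : forall y, y <= 0 ->
     w' y = w y * (x y ^ 2 - lambda * w y ^ 2)).
  { intros y Hy. rewrite Ew', Ew, Ex by exact Hy. reflexivity. }
  assert (Hpos : forall y, y <= 0 -> 0 < w y).
  { intros y Hy.
    apply (linear_growth_pos w w' (3 / 2) y 0 Hw) with (c := 0); try lra.
    - intros t Ht. assert (Ht0 : t <= 0) by lra. rewrite (Hwk t Ht0), Rabs_mult.
      destruct (nbhd_estimates n lambda _ _ _ hn (Htrap t Ht0)) as [H _].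
      rewrite (Rabs_pos_eq (_ - _)) by lra. pose proof (Rabs_pos (w t)). nra.
    - rewrite Ew; lra. }
  constructor; try assumption; intros y Hy;
    destruct (nbhd_estimates n lambda _ _ _ hn (Htrap y Hy)) as [H1 [H2 [H3 _]]].
  - rewrite (Hwk y Hy). pose proof (Hpos y Hy). nra.
  - exact H2.
  - rewrite Ex' by exact Hy. rewrite <- Ew, <- Ex, <- Ev by exact Hy. exact H3.
Qed.

(** * The arclength coordinate *)

(** W' >= W/2 makes W exp(-y/2) nondecreasing, so W(y) <= W(0) exp(y/2) for
    y <= 0. *)
Lemma source_decay (s : R) (W W' X X' : R -> R) :
  source_trajectory s W W' X X' ->
  forall e, 0 < e -> exists N, N <= 0 /\ forall y, y <= N -> W y < e.
Proof.
  intros [HW _ Hpos HW' _ _] e He.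
  assert (H0 : 0 < W 0) by (apply Hpos; lra).
  assert (Hbd : forall y, y <= 0 -> W y * exp (- y / 2) <= W 0).
  { intros y Hy.
    assert (E : W 0 = W 0 * exp (- 0 / 2)).
    { replace (- 0 / 2) with 0 by field. rewrite exp_0. ring. }
    rewrite E.
    apply (derive_nonneg_incr (fun z => W z * exp (- z / 2))
             (fun z => (W' z - W z / 2) * exp (- z / 2)) y 0 Hy).
    - intros x Hx. auto_derive; [exists (W' x); apply HW |].
      rewrite (is_derive_unique (fun z : R => W z) _ _ (HW x)). unfold Rdiv. field.
    - intros x Hx. destruct (HW' x) as [L _]; [lra|].
      apply Rmult_le_pos; [lra | left; apply exp_pos]. }
  (* W(0) exp(y/2) <= e/2 as soon as y <= 2 ln (e / (2 W(0))). *)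
  set (l := ln (e / (2 * W 0))).
  assert (Hl : exp l = e / (2 * W 0)).
  { apply exp_ln. apply Rdiv_lt_0_compat; lra. }
  exists (Rmin 0 (2 * l)). split; [apply Rmin_l|].
  intros y Hy.
  pose proof (Rmin_l 0 (2 * l)). pose proof (Rmin_r 0 (2 * l)).
  assert (Hy0 : y <= 0) by lra.
  assert (Hexp : exp (- l) <= exp (- y / 2)).
  { destruct (Req_dec (- l) (- y / 2)) as [->|]; [lra|].
    left. apply exp_increasing. lra. }
  rewrite exp_Ropp, Hl in Hexp.
  replace (/ (e / (2 * W 0))) with (2 * W 0 * / e) in Hexp by (field; lra).
  specialize (Hbd y Hy0). pose proof (Hpos y Hy0) as Hp.
  assert (Hi : 0 < / e) by (apply Rinv_0_lt_compat; exact He).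
  assert (Hc : W y * (2 * W 0 * / e) <= W 0) by nra.
  apply (Rmult_le_compat_r e) in Hc; [|lra].
  replace (W y * (2 * W 0 * / e) * e) with (2 * W y * W 0) in Hc by (field; lra).
  nra.
Qed.

(** Integrating W/2 <= W' <= 3W/2 over [a,b] gives
    2/3 (W(b) - W(a)) <= int_a^b W <= 2 (W(b) - W(a)); as a -> -oo, W(a)
    vanishes. The integral therefore converges and is comparable to W. *)
Lemma source_arclength (s : R) (W W' X X' : R -> R) :
  source_trajectory s W W' X X' ->
  exists q, (forall y, is_derive q y (W y)) /\
    (forall y, y <= 0 -> 2 / 3 * W y <= q y <= 2 * W y) /\
    (forall y, y <= 0 ->
       is_RInt_gen W (Rbar_locally m_infty) (at_point y) (q y)).
Proof.
  intros HT. pose proof (source_decay _ _ _ _ _ HT) as Hdecay.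
  destruct HT as [HW _ Hpos HW' _ _].
  assert (Hcont : forall y, continuous W y).
  { intros y. apply (ex_derive_continuous W). exists (W' y). apply HW. }
  assert (Hint : forall a b, is_RInt W a b (RInt W a b)).
  { intros a b. apply (RInt_correct W). apply (ex_RInt_continuous W).
    intros z _. apply Hcont. }
  set (P := fun y => RInt W 0 y).
  assert (HP : forall y, is_derive P y (W y)).
  { intros y. apply (is_derive_RInt W P 0 y).
    - apply filter_forall. intros b. apply Hint.
    - apply Hcont. }
  assert (Hchasles : forall a b, is_RInt W a b (P b - P a)).
  { intros a b. replace (P b - P a) with (RInt W a b); [apply Hint|].
    apply is_RInt_unique.
    apply (is_RInt_derive P W a b); intros x _; [apply HP | apply Hcont]. }
  assert (Hmono : forall a b, a <= b -> b <= 0 -> P a <= P b).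
  { intros a b ab Hb. apply (derive_nonneg_incr P W a b ab (fun x _ => HP x)).
    intros x Hx. left. apply Hpos. lra. }
  assert (Hup : forall a b, a <= b -> b <= 0 -> P b - P a <= 2 * (W b - W a)).
  { intros a b ab Hb.
    enough (2 * W a - P a <= 2 * W b - P b) by lra.
    apply (derive_nonneg_incr (fun z => 2 * W z - P z)
             (fun z => 2 * W' z - W z) a b ab).
    - intros x _. apply @is_derive_minus; [| apply HP].
      apply is_derive_scal. apply HW.
    - intros x Hx. destruct (HW' x); lra. }
  assert (Hlow : forall a b, a <= b -> b <= 0 ->
            2 / 3 * (W b - W a) <= P b - P a).
  { intros a b ab Hb.
    enough (P a - 2 / 3 * W a <= P b - 2 / 3 * W b) by lra.
    apply (derive_nonneg_incr (fun z => P z - 2 / 3 * W z)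
             (fun z => W z - 2 / 3 * W' z) a b ab).
    - intros x _. apply @is_derive_minus; [apply HP |].
      apply is_derive_scal. apply HW.
    - intros x Hx. destruct (HW' x); lra. }
  (* -l is the infimum, hence the limit at -oo, of the primitive P. *)
  destruct (completeness (fun r => exists y, y <= 0 /\ r = - P y))
    as [l [Hub Hlub]].
  { exists (2 * W 0 - P 0). intros r [y [Hy ->]].
    pose proof (Hup y 0 Hy (Rle_refl 0)). pose proof (Hpos y Hy). lra. }
  { exists (- P 0), 0. split; [lra | reflexivity]. }
  assert (Hq : forall y, y <= 0 -> 2 / 3 * W y <= P y + l <= 2 * W y).
  { intros y Hy. split.
    - apply le_epsilon. intros e He.
      destruct (Hdecay e He) as [N [HN Hsmall]].
      set (a := Rmin N y). pose proof (Rmin_l N y). pose proof (Rmin_r N y).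
      pose proof (Hsmall a ltac:(unfold a; lra)).
      pose proof (Hlow a y ltac:(unfold a; lra) Hy).
      assert (- P a <= l) by (apply Hub; exists a; split; [unfold a; lra | reflexivity]).
      lra.
    - enough (l <= 2 * W y - P y) by lra.
      apply Hlub. intros r [a [Ha ->]].
      pose proof (Hpos y Hy). pose proof (Hpos a Ha).
      destruct (Rle_lt_dec a y) as [ay|ya].
      + pose proof (Hup a y ay Hy). lra.
      + pose proof (Hmono y a (Rlt_le _ _ ya) Ha). lra. }
  exists (fun y => P y + l). split; [|split].
  - intros y. replace (W y) with (W y + 0) by ring.
    apply @is_derive_plus; [apply HP | apply @is_derive_const].
  - exact Hq.
  - intros y Hy Q [e HQ].
    destruct (Hdecay (e / 2)) as [N [HN Hsmall]].
    { pose proof (cond_pos e). lra. }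
    apply Filter_prod with (fun a => a < N) (fun b => b = y).
    + exists N. intros a Ha. exact Ha.
    + reflexivity.
    + intros a b Ha ->. exists (P y - P a). split; [apply Hchasles|].
      apply HQ. change (Rabs (P y - P a - (P y + l)) < e).
      assert (Ha0 : a <= 0) by lra.
      pose proof (Hq a Ha0). pose proof (Hpos a Ha0).
      pose proof (Hsmall a (Rlt_le _ _ Ha)).
      apply Rabs_def1; lra.
Qed.

Lemma source_arclength_onto (s : R) (W W' X X' q : R -> R) :
  source_trajectory s W W' X X' ->
  (forall y, is_derive q y (W y)) ->
  (forall y, y <= 0 -> q y <= 2 * W y) ->
  forall z, 0 < z <= q 0 -> exists y, y <= 0 /\ q y = z.
Proof.
  intros HT Hq Hup z Hz.
  destruct (source_decay _ _ _ _ _ HT (z / 2)) as [N [HN Hsmall]]; [lra|].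
  pose proof (Hsmall N (Rle_refl N)). pose proof (Hup N HN).
  destruct (IVT_gen q N 0 z (derive_continuity q W Hq)) as [y [Hy Ey]].
  - split; [rewrite Rmin_left | rewrite Rmax_right]; lra.
  - exists y. split; [|exact Ey].
    rewrite Rmax_right in Hy; lra.
Qed.

(** Both omega(x(y)) and x(y) are functions of y, and
    |d omega/dy| <= 4 s / W <= (4 s / W(y1)^2) dx/dy for y >= y1, as W is
    nondecreasing: the Lipschitz bound in x is a comparison of derivatives in y. *)
Lemma source_omega_lipschitz (s : R) (W W' X X' q : R -> R) :
  0 < s -> source_trajectory s W W' X X' ->
  (forall y, is_derive q y (W y)) ->
  forall y1, y1 <= 0 -> exists L, 0 <= L /\
    forall a b, y1 <= a -> a <= b -> b <= 0 ->
      Rabs ((s * X b - 1) / W b - (s * X a - 1) / W a) <= L * (q b - q a).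
Proof.
  intros Hs [HW HX Hpos HW' HXb HX'] Hq y1 Hy1.
  exists (4 * s / W y1 ^ 2).
  assert (H1 : 0 < W y1) by (apply Hpos; exact Hy1).
  split.
  { apply Rdiv_le_0_compat; [lra | nra]. }
  intros a b Ha ab Hb.
  set (L := 4 * s / W y1 ^ 2).
  set (O' := fun y => (s * X' y * W y - (s * X y - 1) * W' y) / W y ^ 2).
  assert (HO : forall y, a <= y <= b ->
            is_derive (fun y => (s * X y - 1) / W y) y (O' y)).
  { intros y Hy. assert (0 < W y) by (apply Hpos; lra). auto_derive.
    - repeat split; try lra; eexists; [apply HX | apply HW].
    - rewrite (is_derive_unique (fun z : R => W z) _ _ (HW y)),
        (is_derive_unique (fun z : R => X z) _ _ (HX y)).
      unfold O'. field. lra. }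
  assert (HOb : forall y, a <= y <= b -> Rabs (O' y) <= L * W y).
  { intros y Hy. assert (Hy0 : y <= 0) by lra.
    pose proof (Hpos y Hy0) as Hw. destruct (HW' y Hy0) as [HwL HwU].
    pose proof (HXb y Hy0) as Hx. pose proof (HX' y Hy0) as Hx'.
    apply Rabs_le_between in Hx'.
    assert (Hmon : W y1 <= W y).
    { apply (derive_nonneg_incr W W' y1 y); [lra | intros x _; apply HW |].
      intros x Hx0. destruct (HW' x); [lra|]. pose proof (Hpos x). lra. }
    unfold O', L, Rdiv. rewrite Rabs_mult, (Rabs_pos_eq (/ _)).
    2:{ left. apply Rinv_0_lt_compat. nra. }
    apply Rle_trans with (4 * s * W y * / W y ^ 2).
    - apply Rmult_le_compat_r; [left; apply Rinv_0_lt_compat; nra|].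
      assert (- (s * W y) <= s * X' y * W y <= s * W y).
      { assert (0 < s * W y) by nra. split; nra. }
      assert (0 <= (s * X y - 1) * W' y <= 2 * s * (3 / 2 * W y)).
      { split; [apply Rmult_le_pos; lra | apply Rmult_le_compat; lra]. }
      apply Rabs_le. lra.
    - rewrite (Rmult_assoc (4 * s) (/ _)), (Rmult_assoc (4 * s) (W y)).
      apply Rmult_le_compat_l; [lra|].
      rewrite (Rmult_comm (/ _)). apply Rmult_le_compat_l; [lra|].
      apply Rinv_le_contravar; nra. }
  assert (I1 := derive_nonneg_incr
     (fun y => L * q y - (s * X y - 1) / W y) (fun y => L * W y - O' y) a b ab).
  assert (I2 := derive_nonneg_incr
     (fun y => L * q y + (s * X y - 1) / W y) (fun y => L * W y + O' y) a b ab).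
  (* L q - omega and L q + omega are both nondecreasing in y. *)
  apply Rabs_le. cbv beta in I1, I2. split.
  - enough (L * q a + (s * X a - 1) / W a <= L * q b + (s * X b - 1) / W b) by lra.
    apply I2; intros y Hy.
    + apply @is_derive_plus; [apply is_derive_scal, Hq | apply HO, Hy].
    + pose proof (HOb y Hy) as B. apply Rabs_le_between in B. lra.
  - enough (L * q a - (s * X a - 1) / W a <= L * q b - (s * X b - 1) / W b) by lra.
    apply I1; intros y Hy.
    + apply @is_derive_minus; [apply is_derive_scal, Hq | apply HO, Hy].
    + pose proof (HOb y Hy) as B. apply Rabs_le_between in B. lra.
Qed.

(** A field on (0,b] blowing up at least like 1/z at 0 and Lipschitz away
    from 0. The constant 2/15 is the product of 2/3, from x >= 2W/3, and 1/5,
    from sqrt n X - 1 >= 1/5. *)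
Definition singular_field (b : R) (omega : R -> R) : Prop :=
  (forall z, 0 < z <= b -> 2 / 15 <= z * omega z) /\
  (forall z0, 0 < z0 <= b -> exists L, 0 <= L /\
     forall z z', z0 <= z <= b -> z0 <= z' <= b ->
       Rabs (omega z' - omega z) <= L * Rabs (z' - z)).

(** The radius is halved because the smallness of the initial point is
    measured coordinatewise: three squares of e/2 sum to less than e^2. *)
Lemma soliton_singular_field (n : nat) (lambda : R)
  (W X Y psi phi omega : R -> R) : (2 <= n)%nat ->
  singular_soliton n lambda (nbhd_radius n lambda / 2) W X Y psi phi omega ->
  singular_field (x_coord W 0) omega.
Proof.
  intros hn [Hode HW0 _ [cW [cX cY]] _ Hom _].
  pose proof (sqrt_INR_bound n hn) as Hs.
  destruct (nbhd_radius_bounds n lambda) as [[He0 _] _].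
  set (e := nbhd_radius n lambda) in *.
  destruct (soliton_source_trajectory n lambda W X Y hn Hode HW0)
    as [w [w' [x [x' [Ew [Ex HT]]]]]].
  { fold e. apply Rabs_def2 in cW. apply Rabs_def2 in cX. apply Rabs_def2 in cY.
    nra. }
  destruct (source_arclength _ _ _ _ _ HT) as [q [Hq [Hqb Hqi]]].
  assert (Hx : forall y, y <= 0 -> x_coord W y = q y).
  { intros y Hy. unfold x_coord. apply is_RInt_gen_unique.
    apply (is_RInt_gen_ext w); [|apply Hqi; exact Hy].
    apply Filter_prod with (fun a => a < y) (fun b => b = y).
    - exists y. intros a Ha. exact Ha.
    - reflexivity.
    - intros a b Ha -> z Hz. apply Ew. simpl in Hz.
      rewrite Rmax_right in Hz; lra. }
  assert (Ho : forall y, y <= 0 ->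
            omega (q y) = (sqrt (INR n) * x y - 1) / w y).
  { intros y Hy. rewrite <- (Hx y Hy), (Hom y Hy), Ew, Ex by exact Hy.
    reflexivity. }
  assert (Honto : forall z, 0 < z <= q 0 -> exists y, y <= 0 /\ q y = z).
  { apply (source_arclength_onto _ _ _ _ _ q HT Hq).
    intros y Hy. apply Hqb. exact Hy. }
  assert (Hqinc : forall a c, a < c -> c <= 0 -> q a < q c).
  { intros a c ac Hc.
    destruct (mean_value q w a c ac) as [m [Hm E]]; [intros t _; apply Hq|].
    assert (0 < w m) by (apply (st_pos _ _ _ _ _ HT); lra). nra. }
  rewrite (Hx 0 (Rle_refl 0)). split.
  - intros z Hz. destruct (Honto z Hz) as [y [Hy <-]].
    rewrite (Ho y Hy). pose proof (Hqb y Hy) as B.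
    pose proof (st_pos _ _ _ _ _ HT y Hy) as Hp.
    pose proof (st_X _ _ _ _ _ HT y Hy) as HX.
    replace (2 / 15) with (2 / 3 * w y * (1 / 5 / w y)) by (field; lra).
    apply Rmult_le_compat; [lra | | lra |].
    + apply Rdiv_le_0_compat; lra.
    + apply Rmult_le_compat_r; [left; apply Rinv_0_lt_compat|]; lra.
  - intros z0 Hz0. destruct (Honto z0 Hz0) as [y0 [Hy0 E0]].
    destruct (source_omega_lipschitz (sqrt (INR n)) w w' x x' q ltac:(lra)
                HT Hq y0 Hy0) as [L [HL Lip]].
    exists L. split; [exact HL|].
    assert (Habove : forall y, y <= 0 -> z0 <= q y -> y0 <= y).
    { intros y Hy Hzy. destruct (Rle_lt_dec y0 y) as [l|l]; [exact l|].
      pose proof (Hqinc y y0 l Hy0). lra. }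
    intros z z' Hz Hz'.
    destruct (Honto z) as [y [Hy Ey]]; [lra|].
    destruct (Honto z') as [y' [Hy' Ey']]; [lra|].
    rewrite <- Ey, <- Ey'. rewrite (Ho y Hy), (Ho y' Hy').
    destruct (Rle_lt_dec y y') as [l|l].
    + rewrite (Rabs_pos_eq (q y' - q y)).
      * apply Lip; [apply Habove; lra | exact l | exact Hy'].
      * destruct (Req_dec y y') as [->|]; [lra|].
        pose proof (Hqinc y y'). lra.
    + rewrite Rabs_minus_sym, (Rabs_minus_sym (q y')).
      pose proof (Hqinc y' y l Hy).
      rewrite (Rabs_pos_eq (q y - q y')) by lra.
      apply Lip; [apply Habove; lra | lra | exact Hy].
Qed.

(** * The flow of a singular field *)

(** 1 + 2 lambda t is affine in t, hence between its values at 0 and at T. *)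
Lemma time_factor_bounds (lambda T : R) : 0 < T ->
  (forall t, 0 <= t <= T -> 0 < 1 + 2 * lambda * t) ->
  exists p0 p1, 0 < p0 /\
    forall t, 0 <= t <= T -> p0 <= / (1 + 2 * lambda * t) <= p1.
Proof.
  intros HT Hp.
  set (mx := Rmax 1 (1 + 2 * lambda * T)). set (mn := Rmin 1 (1 + 2 * lambda * T)).
  assert (Hmn : 0 < mn) by (apply Rmin_pos; [lra | apply Hp; lra]).
  assert (Hmx : 1 <= mx) by apply Rmax_l.
  exists (/ mx), (/ mn). split; [apply Rinv_0_lt_compat; lra|].
  intros t Ht. pose proof (Hp t Ht).
  assert (1 + 2 * lambda * T <= mx) by apply Rmax_r.
  assert (mn <= 1) by apply Rmin_l.
  assert (mn <= 1 + 2 * lambda * T) by apply Rmin_r.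
  split; apply Rinv_le_contravar; try lra;
    destruct (Rle_lt_dec 0 lambda); nra.
Qed.

Section Flow.

Context (lambda delta T : R) (W omega : R -> R) (rho : R -> R -> R).
Context (HT : 0 < T)
  (Hp : forall t, 0 <= t <= T -> 0 < 1 + 2 * lambda * t)
  (Hfield : singular_field (x_coord W 0) omega)
  (Hflow : soliton_flow lambda W omega delta T rho).

Lemma flow_trajectory (x : R) : 0 < x < delta ->
  exists r r', (forall t, 0 <= t <= T -> r t = rho t x) /\
    (forall t, is_derive r t (r' t)) /\
    (forall t, 0 <= t <= T ->
       r' t = / (1 + 2 * lambda * t) * omega (r t)) /\
    (forall t, 0 <= t <= T -> 0 < r t <= x_coord W 0).
Proof.
  intros Hx. destruct Hflow as [_ Hdom Hode].
  destruct (segment_extension (fun s => rho s x)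
    (fun s => / (1 + 2 * lambda * s) * omega (rho s x)) 0 T HT)
    as [r [r' [E [D E']]]].
  { intros t Ht. apply Hode; assumption. }
  exists r, r'. split; [exact E|]. split; [exact D|]. split.
  - intros t Ht. rewrite (E' t Ht), (E t Ht). reflexivity.
  - intros t Ht. rewrite (E t Ht). apply Hdom; assumption.
Qed.

Lemma omega_pos (z : R) : 0 < z <= x_coord W 0 -> 0 < omega z.
Proof.
  intros Hz. destruct Hfield as [H _]. specialize (H z Hz). nra.
Qed.

Lemma flow_incr_time (x s t : R) : 0 < x < delta ->
  0 <= s -> s <= t -> t <= T -> rho s x <= rho t x.
Proof.
  intros Hx Hs st Ht.
  destruct (flow_trajectory x Hx) as [r [r' [E [D [E' Hd]]]]].
  rewrite <- !E by lra.
  apply (derive_nonneg_incr r r' s t st); intros u Hu; [apply D|].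
  rewrite E' by lra. apply Rmult_le_pos; left.
  - apply Rinv_0_lt_compat, Hp. lra.
  - apply omega_pos, Hd. lra.
Qed.

(** The field pushes away from 0 at a speed at least comparable to 1/rho, so
    rho^2 grows at least linearly in time, whatever the starting point. *)
Lemma flow_sq_lower : exists c, 0 < c /\
  forall t x, 0 <= t <= T -> 0 < x < delta -> c * t <= rho t x ^ 2.
Proof.
  destruct (time_factor_bounds lambda T HT Hp) as [p0 [p1 [Hp0 Hpb]]].
  exists (4 / 15 * p0). split; [lra|]. intros t x Ht Hx.
  destruct (flow_trajectory x Hx) as [r [r' [E [D [E' Hd]]]]].
  rewrite <- E by exact Ht.
  enough (r 0 ^ 2 - 4 / 15 * p0 * 0 <= r t ^ 2 - 4 / 15 * p0 * t)
    by (pose proof (pow2_ge_0 (r 0)); lra).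
  apply (derive_nonneg_incr (fun u => r u ^ 2 - 4 / 15 * p0 * u)
           (fun u => 2 * r u * r' u - 4 / 15 * p0) 0 t).
  - lra.
  - intros u _. auto_derive; [exists (r' u); apply D|].
    rewrite (is_derive_unique (fun z : R => r z) _ _ (D u)). ring.
  - intros u Hu. assert (Hu' : 0 <= u <= T) by lra.
    rewrite (E' u Hu').
    destruct Hfield as [H _]. specialize (H _ (Hd u Hu')).
    destruct (Hpb u Hu') as [L _]. nra.
Qed.

(** Trajectories starting from x1 or beyond remain in [x1, x(0)], where omega is
    Lipschitz. The difference of two of them thus satisfies a linear
    differential inequality and keeps its sign. *)
Lemma flow_incr_space (t x1 x2 : R) : 0 <= t <= T ->
  0 < x1 -> x1 < x2 -> x2 < delta -> rho t x1 < rho t x2.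
Proof.
  intros Ht H1 H12 H2.
  assert (Hx1 : 0 < x1 < delta) by lra. assert (Hx2 : 0 < x2 < delta) by lra.
  assert (H0T : 0 <= 0 <= T) by lra.
  assert (Hlow : forall x u, x1 <= x -> x < delta -> 0 <= u <= T -> x1 <= rho u x).
  { intros x u Hx Hxd Hu.
    apply Rle_trans with x; [exact Hx|].
    rewrite <- (flow_init _ _ _ _ _ _ Hflow x) at 1 by lra.
    apply flow_incr_time; lra. }
  destruct Hfield as [_ Hlip].
  destruct (Hlip x1) as [L [HL Lip]].
  { rewrite <- (flow_init _ _ _ _ _ _ Hflow x1 Hx1).
    apply (flow_dom _ _ _ _ _ _ Hflow); assumption. }
  destruct (time_factor_bounds lambda T HT Hp) as [p0 [p1 [Hp0 Hpb]]].
  destruct (flow_trajectory x1 Hx1) as [r1 [r1' [E1 [D1 [E1' Hd1]]]]].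
  destruct (flow_trajectory x2 Hx2) as [r2 [r2' [E2 [D2 [E2' Hd2]]]]].
  enough (0 < r2 t - r1 t) by (rewrite <- E1, <- E2 by exact Ht; lra).
  apply (linear_growth_pos (fun u => r2 u - r1 u) (fun u => r2' u - r1' u)
           (p1 * L) 0 T) with (c := 0).
  - intros u. apply @is_derive_minus; [apply D2 | apply D1].
  - intros u Hu. rewrite E1', E2' by exact Hu.
    rewrite <- Rmult_minus_distr_l, Rabs_mult, (Rmult_assoc p1).
    destruct (Hpb u Hu) as [Hb0 Hb1].
    rewrite (Rabs_pos_eq (/ (1 + 2 * lambda * u))) by lra.
    apply Rmult_le_compat; [lra | apply Rabs_pos | exact Hb1 |].
    pose proof (Hd1 u Hu). pose proof (Hd2 u Hu).
    apply Lip; (split; [|lra]).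
    + rewrite E1 by exact Hu. apply Hlow; lra.
    + rewrite E2 by exact Hu. apply Hlow; lra.
  - exact H0T.
  - exact Ht.
  - rewrite E1, E2 by exact H0T.
    rewrite !(flow_init _ _ _ _ _ _ Hflow) by assumption. lra.
Qed.

End Flow.

(** * The infimum over starting points *)

(** The lower bound [B], together with nonemptiness of (0,delta), makes the
    extended infimum finite, so that [real] returns it unchanged. *)
Lemma flow_inf_glb (rho : R -> R -> R) (delta t B : R) : 0 < delta ->
  (forall x, 0 < x < delta -> B <= rho t x) ->
  (forall x, 0 < x < delta -> flow_inf rho delta t <= rho t x) /\
  (forall c, (forall x, 0 < x < delta -> c <= rho t x) ->
     c <= flow_inf rho delta t).
Proof.
  intros Hd HB. unfold flow_inf.
  set (E := fun z => exists x, 0 < x < delta /\ z = rho t x).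
  destruct (Glb_Rbar_correct E) as [Hlb Hglb].
  assert (HE : E (rho t (delta / 2))).
  { exists (delta / 2). split; [lra | reflexivity]. }
  assert (Hlow : forall c, (forall x, 0 < x < delta -> c <= rho t x) ->
             Rbar_le c (Glb_Rbar E)).
  { intros c Hc. apply Hglb. intros z [x [Hx ->]]. apply Hc. exact Hx. }
  pose proof (Hlow B HB) as H1. pose proof (Hlb _ HE) as H2.
  destruct (Glb_Rbar E) as [m| |]; simpl in *; try contradiction.
  split.
  - intros x Hx. apply (Hlb (rho t x)). exists x. split; [exact Hx | reflexivity].
  - exact Hlow.
Qed.

Lemma increasing_lim_at_0 (f : R -> R) (delta m : R) : 0 < delta ->
  (forall x1 x2, 0 < x1 -> x1 < x2 -> x2 < delta -> f x1 <= f x2) ->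
  (forall x, 0 < x < delta -> m <= f x) ->
  (forall c, (forall x, 0 < x < delta -> c <= f x) -> c <= m) ->
  filterlim f (at_right 0) (locally m).
Proof.
  intros Hd Hinc Hlb Hglb P [e HP].
  assert (Hx : exists x, 0 < x < delta /\ f x < m + e).
  { apply NNPP. intros Hn.
    assert (m + e <= m).
    { apply Hglb. intros x Hx. destruct (Rle_lt_dec (m + e) (f x)) as [l|l];
        [exact l|]. exfalso. apply Hn. exists x. split; assumption. }
    pose proof (cond_pos e). lra. }
  destruct Hx as [x [Hx Hfx]].
  assert (Hx0 : 0 < x) by lra.
  exists (mkposreal x Hx0). intros z Hz Hz0.
  change (Rabs (z - 0) < x) in Hz. apply Rabs_def2 in Hz.
  apply HP. change (Rabs (f z - m) < e).
  assert (f z <= f x) by (apply Hinc; lra).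
  assert (m <= f z) by (apply Hlb; lra).
  apply Rabs_def1; lra.
Qed.

Theorem mainTheorem5 (n : nat) (lambda : R) (hn : (2 <= n)%nat) :
  exists eps : R, 0 < eps /\
  forall W X Y psi phi omega : R -> R,
  singular_soliton n lambda eps W X Y psi phi omega ->
  forall (delta T : R) (rho : R -> R -> R),
  0 < delta -> 0 < T ->
  (forall t, 0 <= t <= T -> 0 < 1 + 2 * lambda * t) ->
  soliton_flow lambda W omega delta T rho ->
  (forall t, 0 <= t <= T ->
     filterlim (rho t) (at_right 0) (locally (flow_inf rho delta t))) /\
  (forall t, 0 < t <= T ->
     0 < flow_inf rho delta t /\
     (forall x, 0 < x < delta -> flow_inf rho delta t < rho t x) /\
     ~ (forall z, 0 < z -> exists x, 0 < x < delta /\ rho t x = z)) /\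
  (forall s t, 0 <= s -> s <= t -> t <= T ->
     flow_inf rho delta s <= flow_inf rho delta t).
Proof.
  exists (nbhd_radius n lambda / 2).
  split; [destruct (nbhd_radius_bounds n lambda) as [[He _] _]; lra|].
  intros W X Y psi phi omega Hsol delta T rho Hdelta HT Hp Hflow.
  pose proof (soliton_singular_field n lambda W X Y psi phi omega hn Hsol) as Hfield.
  assert (Hpos : forall t x, 0 <= t <= T -> 0 < x < delta -> 0 < rho t x).
  { intros t x Ht Hx. apply (flow_dom _ _ _ _ _ _ Hflow); assumption. }
  assert (Hspace := flow_incr_space lambda delta T W omega rho HT Hp Hfield Hflow).
  assert (Hinf : forall t, 0 <= t <= T ->
    (forall x, 0 < x < delta -> flow_inf rho delta t <= rho t x) /\
    (forall c, (forall x, 0 < x < delta -> c <= rho t x) ->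
       c <= flow_inf rho delta t)).
  { intros t Ht. apply (flow_inf_glb rho delta t 0 Hdelta).
    intros x Hx. left. apply Hpos; assumption. }
  split; [|split].
  - intros t Ht. destruct (Hinf t Ht) as [Hlb Hglb].
    apply (increasing_lim_at_0 (rho t) delta); try assumption.
    intros x1 x2 H1 H12 H2. left. apply Hspace; assumption.
  - intros t Ht. assert (Ht' : 0 <= t <= T) by lra.
    destruct (Hinf t Ht') as [Hlb Hglb].
    assert (Hm : 0 < flow_inf rho delta t).
    { destruct (flow_sq_lower lambda delta T W omega rho HT Hp Hfield Hflow)
        as [c [Hc Hsq]].
      apply Rlt_le_trans with (sqrt (c * t)).
      - apply sqrt_lt_R0. nra.
      - apply Hglb. intros x Hx. pose proof (Hpos t x Ht' Hx).
        rewrite <- (sqrt_pow2 (rho t x)) by lra.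
        apply sqrt_le_1_alt, Hsq; assumption. }
    split; [exact Hm|]. split.
    (* The infimum is not attained: rho_t(x/2) lies below rho_t(x). *)
    + intros x Hx. apply Rle_lt_trans with (rho t (x / 2)).
      * apply Hlb. lra.
      * apply Hspace; lra.
    + intros Hsurj.
      destruct (Hsurj (flow_inf rho delta t / 2)) as [x [Hx E]]; [lra|].
      pose proof (Hlb x Hx). lra.
  - intros s t Hs st Ht.
    destruct (Hinf s ltac:(lra)) as [Hlb _]. destruct (Hinf t ltac:(lra)) as [_ Hglb].
    apply Hglb. intros x Hx. apply Rle_trans with (rho s x).
    + apply Hlb. exact Hx.
    + apply (flow_incr_time lambda delta T W omega rho HT Hp Hfield Hflow); assumption.
Qed.
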